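(* Let $G$ be a bipartite graph with $n$ vertices and $m>0$ edges. Then, for any $\alpha\in[0,1]$, $$\lambda_n(B_\alpha(G))\le\frac{2m}{n}(2-3\alpha).$$ Equality occurs if and only if either $\alpha=\frac23$, or $G$ is regular and $\alpha\ge\frac12$.
   Context: All graphs are simple and undirected, with a finite vertex set. $A(G)$ is the adjacency matrix, $D(G)$ the diagonal matrix of vertex degrees, and $L(G)=D(G)-A(G)$ the Laplacian matrix of $G$. For $\alpha\in[0,1]$, $B_\alpha(G):=\alpha A(G)+(1-\alpha)L(G)$. The eigenvalues of a real symmetric $n\times n$ matrix $S$ are ordered $\lambda_1(S)\ge\cdots\ge\lambda_n(S)$, so $\lambda_n$ is the smallest eigenvalue. *)

(* Defs.v *)
From HB Require Import structures.
From mathcomp Require Import all_boot all_order all_algebra.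
From mathcomp Require Import polyrcf.
From mathcomp Require Import reals.

Set Implicit Arguments.
Unset Strict Implicit.
Unset Printing Implicit Defensive.

Import Order.TTheory GRing.Theory Num.Theory.
Local Open Scope ring_scope.

Record sgraph := SGraph {
  vertex :> finType;
  adj : rel vertex;
  adj_sym : symmetric adj;
  adj_irrefl : irreflexive adj }.

Definition edges (G : sgraph) : {set {set G}} :=
  [set [set p.1; p.2] | p : G * G & adj p.1 p.2].

Definition degree (G : sgraph) (x : G) : nat := #|[set y | adj x y]|.

Definition regular (G : sgraph) : Prop :=
  exists r : nat, forall x : G, degree x = r.

(* The two parts are X and its complement; either may be empty. *)
Definition bipartite (G : sgraph) : Prop :=
  exists X : {set G}, forall x y : G, adj x y -> (x \in X) != (y \in X).

(* The vertices are numbered by the canonical enumeration [enum_val] of the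
   vertex type; another numbering gives a permutation-similar matrix. *)
Definition adjmx (R : nzRingType) (G : sgraph) : 'M[R]_#|G| :=
  \matrix_(i, j) (adj (enum_val i) (enum_val j))%:R.

Definition degmx (R : nzRingType) (G : sgraph) : 'M[R]_#|G| :=
  diag_mx (\row_i (degree (enum_val i))%:R).

Definition laplmx (R : nzRingType) (G : sgraph) : 'M[R]_#|G| :=
  degmx R G - adjmx R G.

Definition Bmx (R : nzRingType) (alpha : R) (G : sgraph) : 'M[R]_#|G| :=
  alpha *: adjmx R G + (1 - alpha) *: laplmx R G.

(* [rootsR] lists the distinct roots in increasing order, hence the [rev];
   each root is repeated according to its multiplicity.  The list has length n
   when S is real symmetric, since char_poly S then splits over R. *)
Definition eigenvalues (R : rcfType) (n : nat) (S : 'M[R]_n) : seq R :=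
  flatten [seq nseq (mup x (char_poly S)) x | x <- rev (rootsR (char_poly S))].

(* The index is 1-based: [lambda k S] is the k-th largest eigenvalue of S for
   1 <= k <= n, and lambda n S is the smallest one. *)
Definition lambda (R : rcfType) (n : nat) (k : nat) (S : 'M[R]_n) : R :=
  nth 0 (eigenvalues S) k.-1.

(* Main.v *)
Require Import Defs.
From mathcomp Require Import all_boot all_order all_algebra.
From mathcomp Require Import polyrcf complex spectral sesquilinear.
From mathcomp Require Import ring lra.
From mathcomp Require Import reals.

(** Write [B_alpha = (1 - alpha) D + (2 alpha - 1) A], and let [s] be the vector
    that is 1 on one part of the bipartition and -1 on the other.  Every
    neighbour of a vertex has the opposite sign, so [A s = - D s] and therefore
    [B_alpha s = (2 - 3 alpha) D s].  The degrees add up to [2m]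
    ([handshake]), hence the Rayleigh quotient of [s] is
    [(2m / n) (2 - 3 alpha)]; the smallest eigenvalue is at most that
    ([lambda_le_Rayleigh]).

    If equality holds, [s] minimizes the Rayleigh quotient and so is an
    eigenvector ([lambda_Rayleigh_eq]): [(2 - 3 alpha) deg u] is the same for
    all vertices [u].  Either [alpha = 2/3], or the graph is regular; then
    the Rayleigh quotient of the constant vector, which is [(2m / n) alpha],
    cannot be smaller than [(2m / n) (2 - 3 alpha)], so [alpha >= 1/2].

    Conversely, for [alpha >= 1/2] the form of [B_alpha] is at least
    [(2 - 3 alpha)] times that of [D] ([Bmx_form_ge]).  When [alpha = 2/3] or
    the graph is regular, [(2 - 3 alpha) D] is the scalar
    [(2m / n) (2 - 3 alpha)], so no eigenvalue is smaller
    ([lambda_Bmx_ge]).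

    The link with the definition of [lambda] through roots of the
    characteristic polynomial is the spectral theorem
    ([symmetric_diagonal_form], [lambda_last_min]). *)

Import Order.TTheory GRing.Theory Num.Theory.
Local Open Scope ring_scope.
Local Open Scope sesquilinear_scope.

(** * The smallest eigenvalue of a real symmetric matrix *)

Lemma count_mem_eigenvalues (R : rcfType) (n : nat) (S : 'M[R]_n) (x : R) :
  count_mem x (eigenvalues S) = mup x (char_poly S).
Proof.
have p0 : char_poly S != 0 by rewrite monic_neq0 ?char_poly_monic.
have -> : count_mem x (eigenvalues S) =
    (\sum_(y <- rev (rootsR (char_poly S))) (x == y) * mup y (char_poly S))%N.
  rewrite /eigenvalues; elim: (rev _) => [|y s IHs]; first by rewrite big_nil.
  by rewrite big_cons /= count_cat IHs count_nseq /= eq_sym.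
have Urs : uniq (rev (rootsR (char_poly S))) by rewrite rev_uniq uniq_roots.
have [xs|xNs] := boolP (x \in rev (rootsR (char_poly S))).
  rewrite (bigD1_seq x) //= eqxx mul1n big1 ?addn0 // => y.
  by rewrite eq_sym => /negbTE->.
rewrite big_seq big1 => [|y ys]; last first.
  by case: eqP => // yx; rewrite yx ys in xNs.
rewrite mupNroot //; apply: contra xNs => rx.
by rewrite mem_rev -roots_on_rootsR // rx andbT in_itv.
Qed.

Lemma eigenvalues_nonincreasing (R : rcfType) (n : nat) (S : 'M[R]_n) :
  pairwise >=%R (eigenvalues S).
Proof.
have : pairwise >%R (rev (rootsR (char_poly S))).
  rewrite -sorted_pairwise; last by move=> x y z /= yx xz; apply: lt_trans xz yx.
  by rewrite rev_sorted sorted_roots.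
rewrite /eigenvalues; elim: (rev _) => //= y s IHs /andP[/allP ys /IHs ss].
rewrite pairwise_cat ss andbT; apply/andP; split; last first.
  elim: (mup _ _) => //= k ->; rewrite andbT.
  by apply/allP => z /nseqP[-> _] /=.
apply/allrelP => a b /nseqP[-> _] /flattenP[_ /mapP[z zs ->]] /nseqP[-> _].
by apply/ltW/ys.
Qed.

Lemma char_poly_invmx_conj (F : fieldType) (n : nat) (P A : 'M[F]_n) :
  P \in unitmx -> char_poly (invmx P *m A *m P) = char_poly A.
Proof.
move=> uP; rewrite /char_poly.
have mPV : map_mx polyC (invmx P) *m map_mx polyC P = 1%:M.
  by rewrite -map_mxM mulVmx // map_mx1.
have -> : char_poly_mx (invmx P *m A *m P) =
    map_mx polyC (invmx P) *m char_poly_mx A *m map_mx polyC P.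
  rewrite /char_poly_mx mulmxBr mulmxBl !map_mxM; congr (_ - _).
  by rewrite scalar_mxC -mulmxA mPV mulmx1.
by rewrite !det_mulmx mulrAC -det_mulmx mPV det1 mul1r.
Qed.

(** The spectral theorem over the algebraic closure of [R], read back over [R].
    If the complexified [S] is [P^* D P] with [P] unitary and [D] diagonal with
    real entries [d], then the quadratic form at a real [x] is a sum of the
    [d i] with weights [w i = |(x P^* )_i|^2]; the weights add up to the squared
    norm of [x] because [P] is unitary.  Only these real weights are needed
    afterwards, so that the complex matrices [P] do not appear in the
    statement. *)
Lemma symmetric_diagonal_form (R : rcfType) (n : nat) (S : 'M[R]_n) :
  S^T = S ->
  exists2 d : 'I_n -> R,
    char_poly S = \prod_i ('X - (d i)%:P) &
    forall x : 'rV[R]_n, exists w : 'I_n -> R,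
      [/\ forall i, 0 <= w i,
          \sum_i w i = (x *m x^T) 0 0 &
          \sum_i d i * w i = (x *m S *m x^T) 0 0].
Proof.
move=> Ssym; pose toC := real_complex R.
have realE m1 m2 (M : 'M[R]_(m1, m2)) : map_mx toC M \is a mxOver Num.real.
  by apply/mxOverP => i j; rewrite mxE complex_real.
pose A := map_mx toC S.
have Aherm : A \is hermsymmx.
  apply: realsym_hermsym; last exact: realE.
  rewrite is_hermitianmxE; apply/eqP.
  rewrite expr0 scale1r map_mx_id //.
  by rewrite map_trmx Ssym.
have /orthomx_spectralP AE := hermitian_normalmx Aherm.
have Dreal := hermitian_spectral_diag_real Aherm.
set P := spectralmx A in AE; set D := spectral_diag A in AE Dreal.
have Punitary : P \is unitarymx := spectral_unitarymx A.
pose d i := complex.Re (D 0 i).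
have DE i : D 0 i = toC (d i) by rewrite [RHS]RRe_real //; apply: (mxOverP Dreal).
exists d.
  apply: (map_poly_inj toC); rewrite map_char_poly -/A AE.
  rewrite char_poly_invmx_conj ?spectral_unit // char_poly_trig; last first.
    exact/is_diag_mx_is_trig/diag_mx_is_diag.
  rewrite rmorph_prod; apply: eq_bigr => i _.
  by rewrite /= rmorphB /= map_polyX map_polyC /= !mxE eqxx mulr1n DE.
move=> x; pose y := map_mx toC x *m P ^t*.
exists (fun i => complex.Re (y 0 i) ^+ 2 + complex.Im (y 0 i) ^+ 2).

have wE i : toC (complex.Re (y 0 i) ^+ 2 + complex.Im (y 0 i) ^+ 2) =
    y 0 i * (y ^t* ) i 0.
  by rewrite [LHS]add_Re2_Im2 normCK !mxE.
have conj_x : (map_mx toC x) ^t* = map_mx toC x^T.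
  by rewrite map_trmx realmxC ?map_trmx.
have yC : y ^t* = P *m map_mx toC x^T.
  by rewrite /y trmx_mul map_mxM conj_x trmxCK.
split=> [i||].
- by rewrite addr_ge0 ?sqr_ge0.
- apply: (fmorph_inj toC); rewrite rmorph_sum.
  rewrite (eq_bigr _ (fun i _ => wE i)).
  have -> : \sum_i y 0 i * (y ^t* ) i 0 = (y *m y ^t* ) 0 0 by rewrite mxE.
  rewrite yC /y -mulmxA [P ^t* *m _]mulmxA -invmx_unitary // mulVmx ?mul1mx.
    by rewrite -map_mxM mxE.
  exact: spectral_unit.
- apply: (fmorph_inj toC); rewrite rmorph_sum.
  have -> : \sum_i toC
      (d i * (complex.Re (y 0 i) ^+ 2 + complex.Im (y 0 i) ^+ 2)) = (y *m diag_mx D *m y ^t* ) 0 0.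
    rewrite mul_mx_diag mxE; apply: eq_bigr => i _.
    by rewrite [LHS](rmorphM toC) [X in _ * X]wE -[X in X * _]DE !mxE mulrA (mulrC (D 0 i)).
  have -> : y *m diag_mx D *m y ^t* = map_mx toC x *m A *m map_mx toC x^T.
    by rewrite yC /y -invmx_unitary // [in RHS]AE !mulmxA.
  by rewrite -!map_mxM mxE.
Qed.

(** Where the encoding of [lambda] is tied to an actual minimum: the list of
    eigenvalues is a permutation of the [d i], since both count each value with
    its multiplicity in the characteristic polynomial, so it has length [n],
    and being nonincreasing it ends with its minimum. *)
Lemma lambda_last_min (R : rcfType) (n : nat) (S : 'M[R]_n)
    (d : 'I_n -> R) :
  char_poly S = \prod_i ('X - (d i)%:P) -> (0 < n)%N ->
  (exists i, d i = lambda n S) /\ forall i, lambda n S <= d i.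
Proof.
move=> chS n_gt0; set s := eigenvalues S.
have perm_sd : perm_eq s (codom d).
  apply/allP => x _; apply/eqP.
  rewrite /s count_mem_eigenvalues chS -mu_prod_XsubC.
  by rewrite codomE big_map big_enum.
have size_s : size s = n by rewrite (perm_size perm_sd) size_codom card_ord.
have last_s : (n.-1 < size s)%N by rewrite size_s prednK.
split.
  have /codomP[i ->] : lambda n S \in codom d.
    by rewrite -(perm_mem perm_sd) mem_nth.
  by exists i.
move=> i; have : d i \in s by rewrite (perm_mem perm_sd) codom_f.
case/(nthP 0) => j j_lt <-; rewrite /lambda -/s.
have [<-//|j_neq] := eqVneq j n.-1.
have /(pairwiseP 0) := eigenvalues_nonincreasing _ _ S; apply=> //.
by rewrite ltn_neqAle j_neq -ltnS prednK // -size_s.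
Qed.

(** The form of [S] is a nonnegatively weighted sum of the eigenvalues, of total
    weight the squared norm of [x]. *)
Lemma lambda_le_Rayleigh (R : rcfType) (n : nat) (S : 'M[R]_n) (x : 'rV[R]_n) :
  S^T = S -> lambda n S * (x *m x^T) 0 0 <= (x *m S *m x^T) 0 0.
Proof.
move=> Ssym; case: n => [|n] in S x Ssym *.
  by rewrite !mxE !big_ord0 mulr0.
have [d chS /(_ x)[w [w_ge0 <- <-]]] := symmetric_diagonal_form _ _ _ Ssym.
have [_ le_d] := lambda_last_min _ _ _ _ chS isT.
by rewrite mulr_sumr; apply: ler_sum => i _; rewrite ler_wpM2r.
Qed.

Lemma lambda_last_eigenvalue (R : rcfType) (n : nat) (S : 'M[R]_n) :
  S^T = S -> (0 < n)%N -> eigenvalue S (lambda n S).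
Proof.
move=> Ssym n_gt0.
have [d chS _] := symmetric_diagonal_form _ _ _ Ssym.
have [[i <-] _] := lambda_last_min _ _ _ _ chS n_gt0.
rewrite eigenvalue_root_char chS rootE horner_prod (bigD1 i) //=.
by rewrite !hornerE subrr mul0r.
Qed.

(** Moving from [x] in the direction [y = x M] by [t] changes the form by
    [2 t |y|^2 + t^2 c].  As [x] is already a minimum, this is nonnegative for
    all [t], in particular for small negative [t], which forces [y = 0]. *)
Lemma psd_isotropic_ker (R : realFieldType) (n : nat) (M : 'M[R]_n)
    (x : 'rV[R]_n) :
  M^T = M -> (forall z : 'rV[R]_n, 0 <= (z *m M *m z^T) 0 0) ->
  (x *m M *m x^T) 0 0 = 0 -> x *m M = 0.
Proof.
move=> Msym M_psd x_iso; pose y := x *m M.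
pose b : R := (y *m y^T) 0 0; pose c : R := (y *m M *m y^T) 0 0.
have b_sum : b = \sum_i y 0 i ^+ 2.
  by rewrite /b mxE; apply: eq_bigr => i _; rewrite [y^T _ _]mxE expr2.
have yMx : y *m M *m x^T = y *m y^T by rewrite [in RHS]trmx_mul Msym mulmxA.
have quad t : 0 <= 2 * t * b + t ^+ 2 * c.
  have := M_psd (x + t *: y).
  rewrite linearD linearZ /= !(mulmxDl, mulmxDr) -!(scalemxAl, scalemxAr).
  have mxD (A B : 'M[R]_1) : (A + B) 0 0 = A 0 0 + B 0 0 by rewrite mxE.
  have mxZ a (A : 'M[R]_1) : (a *: A) 0 0 = a * A 0 0 by rewrite mxE.
  rewrite yMx !mxD !mxZ x_iso -/y -/b -/c.
  by congr (_ <= _); ring.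
have c_ge0 : 0 <= c by apply: M_psd.
have b_ge0 : 0 <= b by rewrite b_sum sumr_ge0 // => i _; apply: sqr_ge0.
have b0 : b = 0.
  (* The minimizer is [t = - b / c]; adding 1 to the denominator keeps [t]
     defined when [c = 0] and the value still negative. *)
  have := quad (- b / (c + 1)).
  have c1_gt0 : 0 < c + 1 by rewrite ltr_wpDl.
  have -> : 2 * (- b / (c + 1)) * b + (- b / (c + 1)) ^+ 2 * c =
      - (b ^+ 2 * (c + 2)) / (c + 1) ^+ 2 by field; exact: lt0r_neq0.
  rewrite pmulr_lge0 ?invr_gt0 ?exprn_gt0 // oppr_ge0 pmulr_lle0 ?ltr_wpDl //.
  by rewrite -[_ <= 0]andbT -(sqr_ge0 b) -eq_le sqrf_eq0 => /eqP.
apply/rowP => i; rewrite [RHS]mxE; apply/eqP; rewrite -sqrf_eq0 -/y.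
have /eqP := b0; rewrite b_sum psumr_eq0 => [/allP/(_ i)|j _]; last exact: sqr_ge0.
by rewrite mem_index_enum => /(_ isT).
Qed.

(** Vectors that attain the Rayleigh bound are isotropic for the positive
    semidefinite matrix [S - lambda n S], hence in its kernel. *)
Lemma lambda_Rayleigh_eq (R : rcfType) (n : nat) (S : 'M[R]_n) (x : 'rV[R]_n) :
  S^T = S -> lambda n S * (x *m x^T) 0 0 = (x *m S *m x^T) 0 0 ->
  x *m S = lambda n S *: x.
Proof.
move=> Ssym x_eq; pose M := S - (lambda n S)%:M.
have formE (z : 'rV[R]_n) : (z *m M *m z^T) 0 0 =
    (z *m S *m z^T) 0 0 - lambda n S * (z *m z^T) 0 0.
  rewrite mulmxBr mulmxBl mul_mx_scalar -scalemxAl.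
  by rewrite [LHS]mxE; congr (_ + _); rewrite [LHS]mxE [X in - X]mxE.
have : x *m M = 0.
  apply: psd_isotropic_ker => [|z|]; rewrite ?formE ?x_eq ?subrr //.
    by rewrite linearB /= Ssym tr_scalar_mx.
  by rewrite subr_ge0 lambda_le_Rayleigh.
by rewrite mulmxBr mul_mx_scalar => /eqP; rewrite subr_eq0 => /eqP.
Qed.

(** * Degrees and the quadratic form of a graph *)

Lemma eq_set2 (T : finType) (a b c d : T) :
  ([set a; b] == [set c; d]) = ((a, b) == (c, d)) || ((a, b) == (d, c)).
Proof.
rewrite eqEsubset !subUset !sub1set !inE !xpair_eqE (eq_sym c) (eq_sym d).
rewrite (eq_sym c) (eq_sym d).
by case: (a == c); case: (a == d); case: (b == c); case: (b == d).
Qed.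

(** Each edge is the image of exactly two ordered pairs of adjacent vertices,
    the two being distinct because there are no loops. *)
Lemma handshake (G : sgraph) : (\sum_(u : G) degree u = 2 * #|edges G|)%N.
Proof.
have -> : (\sum_(u : G) degree u = \sum_(p : G * G | adj p.1 p.2) 1)%N.
  rewrite -(pair_big_dep xpredT (@adj G) (fun _ _ => 1%N)) /=.
  by apply: eq_bigr => u _; rewrite sum1_card /degree cardsE.
rewrite (partition_big (fun p : G * G => [set p.1; p.2])
  (mem (edges G))) /=; last first.
  by move=> p p_adj; apply/imsetP; exists p; rewrite ?inE.
rewrite mulnC -sum_nat_const; apply: eq_bigr => _ /imsetP[[a b] ab ->].
rewrite inE /= in ab.
rewrite sum1_card -(_ : #|[set (a, b); (b, a)]| = 2%N); last first.
  by rewrite cards2 xpair_eqE; case: eqP ab => // ->; rewrite adj_irrefl.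
apply: eq_card => -[u v]; rewrite !inE !unfold_in /= eq_set2 andbC.
case: eqP => [[-> ->]|_] /=; first by rewrite ab.
by case: eqP => [[-> ->]|//]; rewrite adj_sym ab.
Qed.

Definition vertex_row (R : nzRingType) (G : sgraph) (f : G -> R) : 'rV[R]_#|G| :=
  \row_i f (enum_val i).

Lemma vertex_row_rank (R : nzRingType) (G : sgraph) (x : 'rV[R]_#|G|) :
  x = vertex_row R G (fun u => x 0 (enum_rank u)).
Proof. by apply/rowP => i; rewrite mxE enum_valK. Qed.

Lemma degree_sum (R : nzRingType) (G : sgraph) (u : G) :
  (degree u)%:R = \sum_(v | adj u v) 1 :> R.
Proof.
rewrite /degree cardsE -sum1_card natr_sum.
by apply: eq_bigl => v; rewrite unfold_in.
Qed.

Lemma trmx_Bmx (R : comNzRingType) (alpha : R) (G : sgraph) :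
  (Bmx alpha G)^T = Bmx alpha G.
Proof.
have AT : (adjmx R G)^T = adjmx R G.
  by apply/matrixP => i j; rewrite !mxE adj_sym.
by rewrite /Bmx /laplmx linearD 2!linearZ linearB /= AT tr_diag_mx.
Qed.

Lemma vertex_row_mulB (R : comNzRingType) (alpha : R) (G : sgraph)
    (f : G -> R) :
  vertex_row R G f *m Bmx alpha G =
  vertex_row R G (fun u => (1 - alpha) * (degree u)%:R * f u
                  + (2 * alpha - 1) * \sum_(v | adj u v) f v).
Proof.
have mulA : vertex_row R G f *m adjmx R G =
    vertex_row R G (fun u => \sum_(v | adj u v) f v).
  apply/rowP => j; rewrite !mxE [RHS]big_mkcond [RHS]big_enum_val /=.
  apply: eq_bigr => i _; rewrite !mxE adj_sym.
  by case: (adj _ _); rewrite (mulr1, mulr0).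
rewrite /Bmx /laplmx /degmx mulmxDr -!scalemxAr mulmxBr mulA mul_mx_diag.
by apply/rowP => i; rewrite !mxE; ring.
Qed.

Lemma vertex_row_dot (R : nzRingType) (G : sgraph) (f g : G -> R) :
  (vertex_row R G f *m (vertex_row R G g)^T) 0 0 = \sum_u f u * g u.
Proof. by rewrite mxE [RHS]big_enum_val; apply: eq_bigr => i _; rewrite !mxE. Qed.

Lemma Bmx_form (R : comNzRingType) (alpha : R) (G : sgraph) (f : G -> R) :
  (vertex_row R G f *m Bmx alpha G *m (vertex_row R G f)^T) 0 0 =
  (1 - alpha) * (\sum_u (degree u)%:R * f u ^+ 2)
  + (2 * alpha - 1) * \sum_u \sum_(v | adj u v) f u * f v.
Proof.
rewrite vertex_row_mulB vertex_row_dot !mulr_sumr -big_split.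
by apply: eq_bigr => u _; rewrite -mulr_sumr /=; ring.
Qed.

Lemma sum_degree_mul (R : nzRingType) (G : sgraph) (g : G -> R) :
  \sum_u (degree u)%:R * g u = \sum_u \sum_(v | adj u v) g u.
Proof.
apply: eq_bigr => u _; rewrite degree_sum mulr_suml.
by under eq_bigr do rewrite mul1r.
Qed.

(** Summing [(f u + f v)^2] over the ordered pairs of adjacent vertices gives
    twice the form of [D + A], so the form of [A] is at least minus that of
    [D].  For [alpha >= 1/2] the coefficient [2 alpha - 1] of [A] in [B_alpha]
    is nonnegative, and the two coefficients combine to
    [(1 - alpha) - (2 alpha - 1) = 2 - 3 alpha]. *)
Lemma Bmx_form_ge (R : realFieldType) (alpha : R) (G : sgraph) (f : G -> R) :
  1 / 2 <= alpha ->
  (2 - 3 * alpha) * (\sum_u (degree u)%:R * f u ^+ 2) <=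
  (vertex_row R G f *m Bmx alpha G *m (vertex_row R G f)^T) 0 0.
Proof.
move=> alpha_ge; rewrite Bmx_form.
set D := \sum_u _ * _; set A := \sum_u \sum_(v | _) _.
have D_swap : D = \sum_u \sum_(v | adj u v) f v ^+ 2.
  rewrite /D sum_degree_mul [RHS](exchange_big_dep xpredT) //=.
  by apply: eq_bigr => u _; apply: eq_bigl => v; rewrite adj_sym.
have : 0 <= \sum_u \sum_(v | adj u v) (f u + f v) ^+ 2.
  by apply: sumr_ge0 => u _; apply: sumr_ge0 => v _; apply: sqr_ge0.
have -> : \sum_u \sum_(v | adj u v) (f u + f v) ^+ 2 = D + D + 2 * A.
  rewrite {1}/D sum_degree_mul D_swap /A mulr_sumr -!big_split.
  apply: eq_bigr => u _ /=; rewrite mulr_sumr -!big_split.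
  by apply: eq_bigr => v _ /=; ring.
by nra.
Qed.

(** The hypothesis on [c] covers both equality cases at once: regular graphs,
    and [alpha = 2/3] with [c = 0].  The bound results from evaluating the form
    at an eigenvector for the smallest eigenvalue. *)
Lemma lambda_Bmx_ge (R : rcfType) (alpha : R) (G : sgraph) (c : R) :
  (0 < #|G|)%N -> 1 / 2 <= alpha ->
  (forall u : G, (2 - 3 * alpha) * (degree u)%:R = c) ->
  c <= lambda #|G| (Bmx alpha G).
Proof.
move=> G_gt0 alpha_ge degc; set l := lambda _ _.
have /eigenvalueP[x xB x_neq0] : eigenvalue (Bmx alpha G) l.
  by apply: lambda_last_eigenvalue => //; apply: trmx_Bmx.
have := Bmx_form_ge _ _ _ (fun u => x 0 (enum_rank u)) alpha_ge.
rewrite -vertex_row_rank xB -scalemxAl [X in _ <= X]mxE.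
rewrite {2 3}(vertex_row_rank _ _ x) vertex_row_dot.
set N := \sum_u _ * x 0 (enum_rank u); have -> : (2 - 3 * alpha) *
    \sum_u (degree u)%:R * x 0 (enum_rank u) ^+ 2 = c * N.
  by rewrite !mulr_sumr; apply: eq_bigr => u _; rewrite mulrA degc expr2.
have N_ge0 (u : G) : 0 <= x 0 (enum_rank u) * x 0 (enum_rank u).
  by rewrite -expr2 sqr_ge0.
rewrite ler_pM2r // lt_def sumr_ge0 // andbT psumr_neq0 //.
have /rV0Pn[i xi] := x_neq0.
apply/hasP; exists (enum_val i); rewrite ?mem_index_enum //=.
by rewrite enum_valK -expr2 lt_def sqrf_eq0 xi sqr_ge0.
Qed.

Lemma lambda_Bmx_le_form (R : rcfType) (alpha : R) (G : sgraph) (f : G -> R) :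
  lambda #|G| (Bmx alpha G) * (\sum_u f u ^+ 2) <=
  (1 - alpha) * (\sum_u (degree u)%:R * f u ^+ 2)
  + (2 * alpha - 1) * \sum_u \sum_(v | adj u v) f u * f v.
Proof.
rewrite -Bmx_form; under eq_bigr do rewrite expr2.
by rewrite -vertex_row_dot lambda_le_Rayleigh // trmx_Bmx.
Qed.

(** * Bipartite graphs *)

Definition part_sign (R : nzRingType) (G : sgraph) (X : {set G}) (u : G) : R :=
  if u \in X then 1 else -1.

Lemma part_sign_sqr (R : nzRingType) (G : sgraph) (X : {set G}) (u : G) :
  part_sign R G X u ^+ 2 = 1.
Proof. by rewrite /part_sign; case: ifP; rewrite ?sqrrN expr1n. Qed.

(** All neighbours of a vertex carry the sign opposite to its own. *)
Lemma part_sign_adj (R : nzRingType) (G : sgraph) (X : {set G}) (u : G) :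
  (forall x y : G, adj x y -> (x \in X) != (y \in X)) ->
  \sum_(v | adj u v) part_sign R G X v = - ((degree u)%:R * part_sign R G X u).
Proof.
move=> bipX; rewrite degree_sum mulr_suml -sumrN; apply: eq_bigr => v /bipX.
by rewrite mul1r /part_sign; do 2!case: (_ \in X); rewrite ?opprK.
Qed.

Theorem theorem4p7 (R : realType) (G : sgraph) (n m : nat)
    (hn : #|G| = n) (hm : #|edges G| = m) (m_gt0 : (0 < m)%N)
    (bipG : bipartite G) (alpha : R) (halpha : 0 <= alpha <= 1) :
  lambda n (Bmx alpha G) <= 2 * m%:R / n%:R * (2 - 3 * alpha) /\
  (lambda n (Bmx alpha G) = 2 * m%:R / n%:R * (2 - 3 * alpha) <->
   alpha = 2 / 3 \/ (regular G /\ 1 / 2 <= alpha)).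
Proof.
(* The size of the matrix depends on [#|G|], so [n] has to be eliminated. *)
subst n; set n := #|G|.
have [X bipX] := bipG; pose s := part_sign R G X.
have sum_deg : \sum_(u : G) (degree u)%:R = 2 * m%:R :> R.
  by rewrite -natr_sum handshake hm natrM.
have sum1G : \sum_(u : G) 1 = n%:R :> R by rewrite sumr_const cardT -cardE.
have mR_gt0 : 0 < m%:R :> R by rewrite ltr0n.
have n_gt0 : (0 < n)%N.
  rewrite lt0n; apply: contraTneq mR_gt0 => n0; rewrite -leNgt.
  have : 2 * m%:R <= 0 :> R.
    rewrite -sum_deg big1 // => u _.
    by have := max_card (pred1 u); rewrite card1 -/n n0.
  by rewrite pmulr_rle0.
have nR_gt0 : 0 < n%:R :> R by rewrite ltr0n.
set l := lambda n _; set t := _ * (2 - 3 * alpha).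
have tn : t * n%:R = 2 * m%:R * (2 - 3 * alpha).
  by rewrite /t mulrAC divfK // lt0r_neq0.
have s_sqr : \sum_u s u ^+ 2 = n%:R.
  by rewrite -sum1G; apply: eq_bigr => u _; apply: part_sign_sqr.
have sB : vertex_row R G s *m Bmx alpha G =
    vertex_row R G (fun u => (2 - 3 * alpha) * (degree u)%:R * s u).
  rewrite vertex_row_mulB; apply/rowP => i; rewrite !mxE part_sign_adj // -/s.
  by ring.
have s_form : (vertex_row R G s *m Bmx alpha G *m (vertex_row R G s)^T) 0 0 =
    t * n%:R.
  rewrite sB vertex_row_dot tn [RHS]mulrC -sum_deg mulr_sumr; apply: eq_bigr => u _.
  by rewrite -[LHS]mulrA -expr2 part_sign_sqr mulr1.
have s_dot : (vertex_row R G s *m (vertex_row R G s)^T) 0 0 = n%:R.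
  by rewrite vertex_row_dot -s_sqr; apply: eq_bigr => u _; rewrite expr2.
have Bsym := trmx_Bmx R alpha G.
have le_lt : l <= t.
  rewrite -(ler_pM2r nR_gt0) -s_form -s_dot.
  exact: lambda_le_Rayleigh.
split=> //; split=> [l_eq|lower].
- have degE (u : G) : (2 - 3 * alpha) * (degree u)%:R = l.
    have : vertex_row R G s *m Bmx alpha G = l *: vertex_row R G s.
      apply: lambda_Rayleigh_eq => //.
      by rewrite s_dot s_form -/n -/l l_eq.
    rewrite sB => /rowP/(_ (enum_rank u)); rewrite !mxE enum_rankK.
    move=> /(congr1 ( *%R^~ (s u))) /=.
    by rewrite -!mulrA -!expr2 part_sign_sqr !mulr1.
  have [->|alpha_neq] := eqVneq alpha (2 / 3); [by left | right; split].
    have coef_neq0 : 2 - 3 * alpha != 0.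
      by apply: contra_neq alpha_neq => coef0; lra.
    have [u0 _] : exists u0 : G, true.
      by have /card_gt0P[u0 _] := n_gt0; exists u0.
    exists (degree u0) => u; apply/eqP; rewrite -(eqr_nat R); apply/eqP.
    by apply: (mulfI coef_neq0); rewrite !degE.
  (* The constant vector has Rayleigh quotient [alpha * 2m/n], which is at
     least [l = (2 - 3 alpha) * 2m/n] only if [alpha >= 1/2]. *)
  have := lambda_Bmx_le_form R alpha G (fun=> 1).
  have -> : \sum_(u : G) (1 : R) ^+ 2 = n%:R.
    by rewrite -sum1G; under eq_bigr do rewrite expr1n.
  have -> : \sum_(u : G) (degree u)%:R * 1 ^+ 2 = 2 * m%:R :> R.
    by rewrite -sum_deg; under eq_bigr do rewrite expr1n mulr1.
  have -> : \sum_(u : G) \sum_(v | adj u v) 1 * 1 = 2 * m%:R :> R.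
    rewrite -sum_deg; apply: eq_bigr => u _.
    by rewrite degree_sum; under eq_bigr do rewrite mulr1.
  rewrite -/n -/l l_eq tn => le_form.
  by nra.
- apply/eqP; rewrite eq_le le_lt /=.
  apply: lambda_Bmx_ge => //.
    by case: lower => [->|[]//]; lra.
  case: lower => [alphaE|[[r degr] _]] u.
    by rewrite /t alphaE; field; rewrite lt0r_neq0.
  have nr : n%:R * r%:R = 2 * m%:R :> R.
    rewrite -sum_deg -sum1G mulr_suml; apply: eq_bigr => v _.
    by rewrite mul1r degr.
  rewrite degr /t -nr; field; exact: lt0r_neq0.
Qed.
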